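(* If $d_1\ge d_2\ge\cdots\ge d_n$, then first-fit satisfies $FF(I)<2\,OPT(I)$ for every such instance $I$ with $OPT(I)\ge2$ (and $FF(I)=1$ when $OPT(I)=1$); in particular first-fit is a 2-approximation on this class.
   Context: Fixed order scheduling with deadlines: there are jobs $J=\{1,\dots,n\}$, each job $j$ having a processing time $p_j\in\mathbb{N}$, $p_j>0$, and a deadline $d_j\in\mathbb{N}$ with $d_j\ge p_j$. All jobs are released at time $0$; job $j$ precedes job $k$ in the fixed order iff $j<k$. A schedule $\tau:J\to\{1,\dots,n\}$ assigns jobs to identical machines; each machine processes its jobs in the fixed order from time $0$ without idle time or preemption, so job $j$ completes at $\sum_{k\le j,\tau(k)=\tau(j)}p_k$; it is feasible if every job completes by its deadline. $OPT(I)$ is the minimum number of machines used by a feasible schedule. First-fit (FF): machines indexed $1,2,\dots$; process jobs in the fixed order and assign each job $j$ to the smallest-index machine whose current load (sum of processing times already assigned) plus $p_j$ is at most $d_j$; $FF(I)$ is the number of nonempty machines. *)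

(* Defs.v *)
(* Jobs are 0-indexed: job j (0 <= j < n) has processing
   time p j and deadline d j; fixed order = index order. *)
From mathcomp Require Import all_boot.
Set Implicit Arguments. Unset Strict Implicit. Unset Printing Implicit Defensive.

Definition schedule (n : nat) := {ffun 'I_n -> 'I_n}.

(* Completion time of job j: sum of processing times of jobs k <= j on
   the same machine (machines run jobs in fixed order, no idle time). *)
Definition completion (n : nat) (p : nat -> nat) (tau : schedule n) (j : 'I_n) : nat :=
  \sum_(k : 'I_n | (k <= j) && (tau k == tau j)) p k.

Definition feasible (n : nat) (p d : nat -> nat) (tau : schedule n) : bool :=
  [forall j : 'I_n, completion p tau j <= d j].

Definition machines_used (n : nat) (tau : schedule n) : nat := #|[set tau j | j : 'I_n]|.

(* OPT: minimum number of machines over feasible schedules (the schedule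
   putting every job on its own machine is feasible when p j <= d j, so
   the default n is never smaller than the true minimum). *)
Definition OPT (n : nat) (p d : nat -> nat) : nat :=
  \big[minn/n]_(tau : schedule n | feasible p d tau) machines_used tau.

Definition ff_step (loads : seq nat) (job : nat * nat) : seq nat :=
  let: (pj, dj) := job in
  let i := find (fun l => l + pj <= dj) loads in
  if i < size loads then set_nth 0 loads i (nth 0 loads i + pj)
  else rcons loads pj.

Definition FF (n : nat) (p d : nat -> nat) : nat :=
  size (foldl ff_step [::] [seq (p j, d j) | j <- iota 0 n]).

(* Main.v *)
Require Import Defs.
From mathcomp Require Import all_boot zify.

(** With nonincreasing deadlines a schedule is feasible iff the load of every
    machine is at most the deadline of its last job.  Sort the [m] machines of a
    feasible schedule by their last jobs [l 0 <= ... <= l m.-1], and suppose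
    that first-fit opens at least [2 * m] machines, machine [b] being opened by
    job [f b].  Let [i] be minimal with [f q.*2.+1 <= l q] for all
    [i <= q < m]; then [i < m], as no job comes after [l m.-1].  Every job that
    first-fit puts on a machine of index at least [2 * i] comes after
    [l i.-1], so the schedule has it on a machine of index at least [i]; the
    total size of these jobs is therefore at most the sum of the [d (l q)],
    [i <= q < m].  But the first-fit machines [q.*2] and
    [q.*2.+1] together carry more than [d (f q.*2.+1) >= d (l q)]. *)

(** Replaces the fold by data on jobs: [a j] is the machine of job [j], and [f b] the job that opens
    machine [b]. Machines open in index order, hence the third clause. *)
Lemma FF_assignment (n : nat) (p d : nat -> nat) :
  exists a f : nat -> nat,
  [/\ forall j, j < n -> a j < FF n p d,
      forall b, b < FF n p d -> f b < n /\ a (f b) = b,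
      forall j b, j < n -> b <= a j -> f b <= j
    & forall j b, j < n -> b < a j ->
        d j < \sum_(i < j | a i == b) p i + p j].
Proof.
(* The induction on [n] also needs the current loads, since first-fit decides by them. *)
suff: exists a f : nat -> nat,
  let L := foldl ff_step [::] [seq (p j, d j) | j <- iota 0 n] in
  [/\ forall j, j < n -> a j < size L,
      forall b, b < size L -> f b < n /\ a (f b) = b,
      forall j b, j < n -> b <= a j -> f b <= j,
      forall j b, j < n -> b < a j ->
        d j < \sum_(i < j | a i == b) p i + p j
    & forall b, b < size L -> nth 0 L b = \sum_(i < n | a i == b) p i].
  by case=> a [f [H1 H2 H3 H4 _]]; exists a, f.
elim: n => [|n [a [f]]]; first by exists id, id; split.
rewrite -addn1 iotaD map_cat foldl_cat addn1 /= add0n.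
set L := foldl _ _ _ => -[aL fL fmin aFF Lval].
set c := find (fun l => l + p n <= d n) L.
(* When job [n] fits nowhere, [find] returns [size L], the index of the machine about to be opened,
   so [c] is right in both cases. *)
pose a' j := if j == n then c else a j.
have a'E j : j < n -> a' j = a j by rewrite /a' => jn; case: eqP => //; lia.
have a'n : a' n = c by rewrite /a' eqxx.
have sumE j b : j <= n ->
    \sum_(i < j | a' i == b) p i = \sum_(i < j | a i == b) p i.
  by move=> jn; apply: eq_bigl => i; rewrite a'E // (leq_trans (ltn_ord i)).
have sumS b : \sum_(i < n.+1 | a' i == b) p i =
    \sum_(i < n | a i == b) p i + (if c == b then p n else 0).
  by rewrite big_mkcond big_ord_recr /= -big_mkcond /= sumE // a'n.
have cL : c <= size L by exact: find_size.
have a'FF j b : j < n.+1 -> b < a' j ->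
    d j < \sum_(i < j | a' i == b) p i + p j.
  rewrite ltnS leq_eqVlt => /orP[/eqP->|jn].
    rewrite a'n sumE // => bc; have bL : b < size L by lia.
    by rewrite -Lval // ltnNge; apply/negP => h; have := before_find 0 bc; rewrite /= h.
  by rewrite a'E // sumE ?(ltnW jn) //; exact: aFF.
case: ifPn => [cltL|cgeL].
- exists a', f; rewrite size_set_nth (maxn_idPr cltL); split=> //.
  + by move=> j jn; rewrite /a'; case: eqP => // /eqP ?; apply: aL; lia.
  + by move=> b /fL[fn ab]; rewrite a'E //; split; first exact: ltnW.
  + move=> j b; rewrite ltnS leq_eqVlt => /orP[/eqP->|jn].
      by rewrite a'n => bc; case: (fL b); lia.
    by rewrite a'E //; exact: fmin.
  + move=> b bL; rewrite nth_set_nth /= sumS eq_sym.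
    by case: (eqVneq c b) => [<-|_]; rewrite Lval ?addn0.
- have {cgeL}cL : c = size L by lia.
  pose f' b := if b < size L then f b else n.
  exists a', f'; rewrite size_rcons; split=> //.
  + by move=> j jn; rewrite /a'; case: eqP => [|/eqP ?]; rewrite ?cL // ltnW // ltnS aL //; lia.
  + move=> b bL; rewrite /f'; case: ifPn => [/fL[fn ab]|bgeL].
      by rewrite a'E //; split; first exact: ltnW.
    by rewrite a'n cL; split; lia.
  + move=> j b; rewrite ltnS leq_eqVlt /f' => /orP[/eqP->|jn].
      by move=> _; case: ifP => // /fL[/ltnW].
    by rewrite a'E // => baj; rewrite (leq_ltn_trans baj (aL _ jn)) fmin.
  + move=> b bL; rewrite nth_rcons sumS cL eq_sym.
    case: (ltngtP b (size L)) => [bL'|bL'|->].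
    * by rewrite Lval // addn0.
    * by move: bL'; rewrite ltnNge -ltnS bL.
    * by rewrite big1 // => i /eqP ai; have := aL _ (ltn_ord i); rewrite ai ltnn.
Qed.

(** The last alternative expresses the minimality of [i]: the inequality fails just below it. *)
Lemma last_crossing (m : nat) (g l : nat -> nat) :
  exists i, [/\ i <= m, forall q, i <= q < m -> g q <= l q
              & i = 0 \/ l i.-1 < g i.-1].
Proof.
elim: m => [|m [i [im gl il]]]; first by exists 0; split=> [|q|]; lia.
case: (leqP (g m) (l m)) => h; last by exists m.+1; split=> [|q|/=]; lia.
exists i; split=> //; first exact: ltnW.
by move=> q; case: (eqVneq q m) => [->//|qm] ?; apply: gl; lia.
Qed.

Lemma sum_fibers (n i m : nat) (p : nat -> nat) (o : 'I_n -> nat) :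
  \sum_(i <= q < m) \sum_(j < n | o j == q) p j =
  \sum_(j < n | i <= o j < m) p j.
Proof.
rewrite (exchange_big_dep predT) //= [RHS]big_mkcond; apply: eq_bigr => j _.
by under eq_bigl do rewrite eq_sym; rewrite big_nat1_eq.
Qed.

Lemma FF_lt_sorted_packing (n m : nat) (p d : nat -> nat)
    (o : 'I_n -> nat) (l : nat -> nat) :
  (forall j k, j <= k -> k < n -> d k <= d j) ->
  0 < m -> (forall j, o j < m) ->
  (forall q, q < m -> l q < n) ->
  (forall q r, q <= r -> r < m -> l q <= l r) ->
  (forall j : 'I_n, j <= l (o j)) ->
  (forall q, q < m -> \sum_(j < n | o j == q) p j <= d (l q)) ->
  FF n p d < 2 * m.
Proof.
move=> dmono m0 om ln lmono jl load; rewrite ltnNge; apply/negP => mFF.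
have [a [f [aFF ff fmin afit]]] := FF_assignment n p d.
have [i [im gl il]] := last_crossing m (fun q => f q.*2.+1) l.
(* For [i > 0], machine [i.-1.*2.+1] is open by the time of [j], so
   [l i.-1 < f i.-1.*2.+1 <= j <= l (o j)]; as [l] is monotone, [o j] exceeds [i.-1]. *)
have fo (j : 'I_n) : i <= (a j)./2 -> i <= o j.
  case: il => [->//|lf] iaj; rewrite leqNgt; apply/negP => oi.
  have i1m : i.-1 < m by lia.
  have := lmono (o j) i.-1; have := jl j; have := fmin j i.-1.*2.+1 (ltn_ord j).
  lia.
have {}im : i < m.
  have fF : m.*2.-1 < FF n p d by lia.
  have [fn afE] := ff _ fF.
  case: (ltnP i m) => // mi; have := fmin (f m.*2.-1) i.-1.*2.+1 fn.
  have im' : i = m by lia.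
  have := jl (Ordinal fn); have := om (Ordinal fn) => oq jlq.
  have := lmono (o (Ordinal fn)) i.-1; rewrite /= in jlq.
  by case: il => [|]; lia.
(* The opener of machine [q.*2.+1] did not fit on machine [q.*2]; its size and the load it met there
   both count towards the pair. *)
have pair q : q < m -> d (f q.*2.+1) < \sum_(j < n | (a j)./2 == q) p j.
  move=> qm; have [fn afE] : f q.*2.+1 < n /\ a (f q.*2.+1) = q.*2.+1 by apply: ff; lia.
  have := afit _ q.*2 fn; rewrite afE => /(_ (ltnSn _)) /leq_trans; apply.
  rewrite (bigD1 (Ordinal fn)) /= ?afE; last by apply/eqP; lia.
  rewrite addnC leq_add2l (big_ord_widen_cond n (fun i => a i == q.*2)) //; last exact: ltnW.
  rewrite big_mkcond [leqRHS]big_mkcond; apply: leq_sum => j _.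
  case: andP => // -[/eqP aj jf]; rewrite aj doubleK eqxx /=.
  by case: eqP => // jE; move: jf; rewrite jE /= ltnn.
(* Absurd, because the range is nonempty: the left side is larger by [m - i]. *)
suff: \sum_(i <= q < m) (d (f q.*2.+1)).+1 <= \sum_(i <= q < m) d (f q.*2.+1).
  under eq_bigr do rewrite -addn1.
  by rewrite big_split /= sum_nat_const_nat; lia.
apply: (@leq_trans (\sum_(i <= q < m) \sum_(j < n | o j == q) p j)).
  apply: (@leq_trans (\sum_(i <= q < m) \sum_(j < n | (a j)./2 == q) p j)).
    rewrite big_nat_cond [leqRHS]big_nat_cond.
    by apply: leq_sum => q /andP[/andP[_ qm] _]; apply: pair.
  rewrite (sum_fibers n i m p (fun j => (a j)./2)) (sum_fibers n i m p o).
  rewrite big_mkcond [leqRHS]big_mkcond; apply: leq_sum => j _.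
  by case: ifP => // /andP[/fo -> _]; rewrite om.
rewrite big_nat_cond [leqRHS]big_nat_cond.
apply: leq_sum => q /andP[/andP[iq qm] _].
by apply: leq_trans (load _ qm) _; apply: dmono; [apply: gl; rewrite iq|apply: ln].
Qed.

Lemma FF_lt_machines_used (n : nat) (p d : nat -> nat) (tau : schedule n) :
  (forall j k, j <= k -> k < n -> d k <= d j) ->
  0 < n -> feasible p d tau -> FF n p d < 2 * machines_used tau.
Proof.
case: n tau => // n tau dmono _ /forallP feas.
pose A := [set tau j | j : 'I_n.+1].
pose last_job (x : 'I_n.+1) : nat := \max_(j : 'I_n.+1 | tau j == x) j.
pose s := sort (relpre last_job leq) (enum A).
have tauA j : tau j \in s by rewrite mem_sort mem_enum imset_f.
have sizes : size s = machines_used tau by rewrite size_sort -cardE.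
(* A used machine has a job, so its maximum is attained and is not the default 0. *)
have sA x : x \in s -> exists j : 'I_n.+1, tau j = x /\ last_job x = j.
  rewrite mem_sort mem_enum => /imsetP[j0 _ xE].
  have [j tj jE] := @eq_bigmax_cond _ (fun j => tau j == x) (fun j => nat_of_ord j)
    (introT card_gt0P (ex_intro _ j0 (introT eqP (esym xE)))).
  by exists j; split; [exact/eqP|exact: jE].
have ssorted : sorted (relpre last_job leq) s.
  by apply: sort_sorted => x y; apply: leq_total.
apply: (@FF_lt_sorted_packing _ _ _ _ (fun j => index (tau j) s)
          (fun q => last_job (nth ord0 s q))) => //; rewrite -?sizes.
- by have := tauA ord0; case: (s).
- by move=> j; rewrite index_mem.
- by move=> q qs; have [j [_ ->]] := sA _ (mem_nth ord0 qs).
- move=> q r qr rs; apply: (sorted_leq_nth _ _ ord0 ssorted) => //.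
  + by move=> x y z /=; apply: leq_trans.
  + by move=> x /=.
  + by rewrite inE (leq_ltn_trans qr).
- move=> j; rewrite nth_index //.
  exact: (@leq_bigmax_cond _ (fun k => tau k == tau j) (fun k => nat_of_ord k)).
- move=> q qs; have [j [tj ljE]] := sA _ (mem_nth ord0 qs).
  (* The last job of a machine completes when the whole load is done. *)
  rewrite ljE; apply: leq_trans (feas j); rewrite /completion.
  rewrite big_mkcond [leqRHS]big_mkcond; apply: leq_sum => k _.
  case: eqP => // kq; have tk : tau k = nth ord0 s q by rewrite -kq nth_index.
  rewrite tk tj eqxx -ljE.
  by rewrite (@leq_bigmax_cond _ (fun k => tau k == _) (fun k => nat_of_ord k)) // tk.
Qed.

Lemma OPT_attained (n : nat) (p d : nat -> nat) :
  (forall j, j < n -> p j <= d j) ->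
  exists2 tau : schedule n, feasible p d tau & machines_used tau <= OPT n p d.
Proof.
move=> pd; rewrite /OPT.
apply: (big_ind (fun x => exists2 tau : schedule n,
  feasible p d tau & machines_used tau <= x)).
(* The default [n] of the minimum is covered by giving each job its own machine. *)
- exists [ffun j => j]; last by rewrite -[leqRHS]card_ord max_card.
  apply/forallP => j; rewrite /completion (big_pred1 j) ?pd // => k.
  rewrite !ffunE /=; case: (eqVneq k j) => [->|]; rewrite ?leqnn ?andbF //.
- by move=> x y; rewrite /minn; case: ifP.
- by move=> tau feas; exists tau.
Qed.

Lemma OPT_le (n : nat) (p d : nat -> nat) : OPT n p d <= n.
Proof.
by apply: (big_rec (fun x => x <= n)) => // tau x _ xn; rewrite geq_min xn orbT.
Qed.

Theorem mainTheorem7 (n : nat) (p d : nat -> nat)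
  (hp : forall j, j < n -> 0 < p j)
  (hpd : forall j, j < n -> p j <= d j)
  (hd : forall j k, j <= k -> k < n -> d k <= d j) :
  (2 <= OPT n p d -> FF n p d < 2 * OPT n p d) /\
  (OPT n p d = 1 -> FF n p d = 1).
Proof.
have FF_lt : 0 < OPT n p d -> FF n p d < 2 * OPT n p d.
  move=> /leq_trans /(_ (OPT_le n p d)) n0.
  have [tau feas used] := OPT_attained n p d hpd.
  apply: leq_trans (FF_lt_machines_used n p d tau hd n0 feas) _.
  by rewrite leq_mul2l used orbT.
split=> [/ltnW //|OPT1].
have n0 : 0 < n by rewrite -OPT1 OPT_le.
(* Job 0 occupies a machine, so [FF] is positive, while the bound reads [FF n p d < 2]. *)
have [a [f [/(_ 0 n0) aFF _ _ _]]] := FF_assignment n p d.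
by move: FF_lt; rewrite OPT1 => /(_ isT); lia.
Qed.
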